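(* Let $p$ be an odd prime and $L=\mathbb F_{p^m}\subset F=\mathbb F_{p^{2m}}$. Up to isotopy, the second Budaghyan–Helleseth family of commutative semifields is contained in the union of the first Budaghyan–Helleseth family and the following family: the presemifields $B(p,m,s,1/\omega^{\sigma-1},n,n^{(\sigma-1)/2})$, where $n\in L$ is a non-square, $0<s<m$, $\sigma=p^s$, and at least one of $m/\gcd(s,m)$, $s/\gcd(s,m)$ is even.
   Context: A finite presemifield $(F,+,* )$ is a finite abelian group $(F,+)$ with a multiplication satisfying both distributive laws and such that $x*y=0$ implies $x=0$ or $y=0$. Two presemifields $(F,+,* )$, $(F',+,*')$ are isotopic if there are additive group isomorphisms $A,B,C\colon F\to F'$ with $A(x)*'B(y)=C(x*y)$ for all $x,y$. For an integer $k\ge0$, $L^k=\{x^k:x\in L\}$. Write $\overline{x}=x^{p^m}$ for $x\in F$, and $T(x)=x+\overline{x}$; fix $\omega\in F^*$ with $T(\omega)=0$, so that $\omega^2\in L$ is a non-square in $L$. A planar function $f\colon F\to F$ of the types below determines a commutative presemifield $x\circ y=f(x+y)-f(x)-f(y)$ on $F$. First family: the presemifields determined by the planar functions $$f(x)=(bx)^{\sigma+1}-\overline{(bx)^{\sigma+1}}+\sum_{i=0}^{m-1}c_i(x\overline{x})^{p^i},$$ where $\sigma=p^s$ with $0<s<m$, $b\in F^*$, $c_i\in L$, the map $y\mapsto\sum_i c_iy^{p^i}$ is an invertible map $L\to L$, $\gcd(m+s,2m)=\gcd(m+s,m)$, and $\gcd(p^s+1,p^m+1)\ne\gcd(p^s+1,(p^m+1)/2)$.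 Second family: the presemifields determined by the planar functions $$f(x)=\beta x^{\sigma+1}+\overline{\beta x^{\sigma+1}}+\gamma\, x\overline{x}+\sum_{i=0}^{m-1}r_i(x\overline{x})^{p^i},$$ where $\sigma=p^s$ with $0<s<m$, $\beta\in F$ is a non-square, $\gamma\in F\setminus L$, $r_i\in L$, and $\gcd(m+s,2m)=\gcd(m+s,m)$. For $l,n,N\in L^*$ with $-l\notin L^{\sigma-1}$ and $x^{\sigma+1}+(1-1/N)x+(1/n-1)/N\ne0$ for all $x\in L$, the presemifield $B(p,m,s,l,n,N)$ is the additive group $L^2$ with multiplication $(a,b)*(c,d)=(h(a,b,c,d),\,ad+bc)$, where $$h(a,b,c,d)=ac^{\sigma}-nNbd^{\sigma}+l(a^{\sigma}c-nNb^{\sigma}d)+n\{Nad^{\sigma}-bc^{\sigma}+l(a^{\sigma}d-Nb^{\sigma}c)\};$$ the family in the claim consists of those parameters for which these conditions hold. *)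

(* Defs.v *)
From HB Require Import structures.
From mathcomp Require Import all_boot all_algebra.

Set Implicit Arguments.
Unset Strict Implicit.
Unset Printing Implicit Defensive.

Import GRing.Theory.
Local Open Scope ring_scope.

(* MathComp has the additive and finite structures on products, but not their
   join. *)
HB.saturate prod.

Record presemifield (V : finZmodType) := Presemifield {
  psmul :> V -> V -> V;
  psmulDl : left_distributive psmul +%R;
  psmulDr : right_distributive psmul +%R;
  psmul_eq0 : forall x y, psmul x y = 0 -> x = 0 \/ y = 0
}.

Definition isotopic (V W : finZmodType)
    (P : presemifield V) (Q : presemifield W) : Prop :=
  exists A B C : {additive V -> W},
    [/\ bijective A, bijective B, bijective C
      & forall x y, Q (A x) (B y) = C (P x y)].

Definition is_power (K : finFieldType) (k : nat) (x : K) : Prop :=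
  exists y : K, x = y ^+ k.

Definition planar (K : finFieldType) (f : K -> K) : Prop :=
  forall a : K, a != 0 -> bijective (fun x => f (x + a) - f x).

Definition polarization (K : finFieldType) (f : K -> K) (x y : K) : K :=
  f (x + y) - f x - f y.

Section Families.

(* The inclusion of L = F_(p^m) in F = F_(p^(2m)) is the field morphism iota;
   p and m are tied to the cardinalities of L and F in the theorem. *)
Variables (p m : nat) (L F : finFieldType) (iota : {rmorphism L -> F}).

Definition conjF (x : F) : F := x ^+ (p ^ m).

Definition trF (x : F) : F := x + conjF x.

Definition bh1_fun (s : nat) (b : F) (c : 'I_m -> L) (x : F) : F :=
  (b * x) ^+ (p ^ s + 1) - conjF ((b * x) ^+ (p ^ s + 1))
  + \sum_(i < m) iota (c i) * (x * conjF x) ^+ (p ^ i).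

Definition bh1_cond (s : nat) (b : F) (c : 'I_m -> L) : Prop :=
  [/\ (0 < s < m)%N,
      b != 0,
      bijective (fun y : L => \sum_(i < m) c i * y ^+ (p ^ i)),
      gcdn (m + s) (2 * m) = gcdn (m + s) m
    & gcdn (p ^ s + 1) (p ^ m + 1) <> gcdn (p ^ s + 1) ((p ^ m + 1) %/ 2)].

Definition first_BH_family (P : presemifield F) : Prop :=
  exists (s : nat) (b : F) (c : 'I_m -> L),
    [/\ bh1_cond s b c,
        planar (bh1_fun s b c)
      & forall x y, P x y = polarization (bh1_fun s b c) x y].

Definition bh2_fun (s : nat) (beta gamma : F) (r : 'I_m -> L) (x : F) : F :=
  beta * x ^+ (p ^ s + 1) + conjF (beta * x ^+ (p ^ s + 1))
  + gamma * (x * conjF x)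
  + \sum_(i < m) iota (r i) * (x * conjF x) ^+ (p ^ i).

Definition bh2_cond (s : nat) (beta gamma : F) : Prop :=
  [/\ (0 < s < m)%N,
      ~ is_power 2 beta,
      ~ (exists z : L, gamma = iota z)
    & gcdn (m + s) (2 * m) = gcdn (m + s) m].

Definition second_BH_family (P : presemifield F) : Prop :=
  exists (s : nat) (beta gamma : F) (r : 'I_m -> L),
    [/\ bh2_cond s beta gamma,
        planar (bh2_fun s beta gamma r)
      & forall x y, P x y = polarization (bh2_fun s beta gamma r) x y].

Definition B_h (s : nat) (l n N a b c d : L) : L :=
  a * c ^+ (p ^ s) - n * N * b * d ^+ (p ^ s)
  + l * (a ^+ (p ^ s) * c - n * N * b ^+ (p ^ s) * d)
  + n * (N * a * d ^+ (p ^ s) - b * c ^+ (p ^ s)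
         + l * (a ^+ (p ^ s) * d - N * b ^+ (p ^ s) * c)).

Definition B_mul (s : nat) (l n N : L) (u v : L * L) : L * L :=
  (B_h s l n N u.1 u.2 v.1 v.2, u.1 * v.2 + u.2 * v.1).

Definition B_cond (s : nat) (l n N : L) : Prop :=
  [/\ l != 0, n != 0, N != 0,
      ~ is_power (p ^ s - 1) (- l)
    & forall x : L,
        x ^+ (p ^ s + 1) + (1 - N^-1) * x + (n^-1 - 1) / N != 0].

(* 1/omega^(sigma-1) lies in L when omega has trace 0; l is its preimage
   under iota. *)
Definition B_family (omega : F) (P : presemifield (L * L)%type) : Prop :=
  exists (s : nat) (l n N : L),
    [/\ (0 < s < m)%N,
        ~~ odd (m %/ gcdn s m) \/ ~~ odd (s %/ gcdn s m),
        ~ is_power 2 n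
      & [/\ iota l = (omega ^+ (p ^ s - 1))^-1,
            N = n ^+ ((p ^ s - 1) %/ 2),
            B_cond s l n N
          & forall u v, P u v = B_mul s l n N u v]].

End Families.

(* Main.v *)
From HB Require Import structures.
Require Import Defs.
From mathcomp Require Import all_boot all_algebra fingroup cyclic finfield ring zify.

Set Implicit Arguments.
Unset Strict Implicit.
Unset Printing Implicit Defensive.

Import GRing.Theory.
Local Open Scope ring_scope.

(** Write [q = p^m], [sigma = p^s], [ {x,y} = x^sigma y + x y^sigma ] and
    [ <x,y> = x conj(y) + conj(x) y ].  A member of the second family multiplies
    by
      [ x o y = Tr (beta {x,y}) + gamma <x,y> + phi <x,y> ],
    with [phi] additive and preserving [L].  The trace and [<x,y>] both lie in
    [L], and [gamma] does not, so an additive bijection of [F] recovers the pair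
    [(Tr (beta {x,y}), <x,y>)] from the product: up to isotopy only this pair
    matters, that is, only the class of [beta].  Substituting [u x] for [x] and
    scaling the first entry moves [beta] within its class modulo
    [L^* (F^* )^(sigma+1)].

    The condition [gcd(m+s, 2m) = gcd(m+s, m)] says that exactly one of
    [m / gcd(s,m)] and [s / gcd(s,m)] is even ([gcd_cond_parity]), and then
    [gcd(sigma+1, q+1) = 2] ([gcd_expn_succ]).  As [L^*] consists of the
    [(q+1)]-th powers, [L^* (F^* )^(sigma+1)] is the group of nonzero squares
    ([square_decomposition]).  Hence any nonsquare [beta] may be replaced by any
    other one, and it suffices to reach one convenient nonsquare.

    - If [q = 1 mod 4], then [omega] is itself a nonsquare of [F]
      ([trace0_nonsquare]).  For [beta = omega] the trace of [beta z] is
      [omega (z - conj z)], which is the shape of the first family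
      ([bh2_isotopic_bh1]).
    - If [q = 3 mod 4], choose [n = - a^2] with [1 + a^2] a nonsquare of [L]
      ([exists_nonsquare_succ_square]) and [theta] with [theta^2 = n].  Then
      [beta = 1 - theta/n] is a nonsquare, its norm being [(1 + a^2)/a^2].
      Writing [x = a + theta b] and separating [ {x,y} ] into coordinates, the
      pair becomes the product of the presemifield
      [B(p,m,s,1/omega^(sigma-1),n,n^((sigma-1)/2))], after the two coordinates
      of the second factor are exchanged and rescaled ([bh2_isotopic_B]).

    Neither target needs to be shown free of zero divisors beforehand: this is
    transported from the given presemifield along the isotopism
    ([isotopic_transport]), and in turn yields planarity in the first case
    ([presemifield_planar]) and the conditions on [l, n, N] in the second
    ([presemifield_B_cond]). *)

(** * Presemifields and isotopy *)

Lemma zmod_morphism_bundled (V W : zmodType) (f : V -> W) :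
  zmod_morphism f -> exists g : {additive V -> W}, g =1 f.
Proof.
move=> fB.
pose fM := GRing.isZmodMorphism.Build V W f fB.
pose g : {additive V -> W} := HB.pack f fM.
by exists g.
Qed.

Lemma zmod_morphism_inj (V W : zmodType) (f : V -> W) :
  zmod_morphism f -> (forall x, f x = 0 -> x = 0) -> injective f.
Proof.
move=> fB f0 x y fxy; apply/eqP; rewrite -subr_eq0; apply/eqP/f0.
by rewrite fB fxy subrr.
Qed.

(** Isotopisms carry a presemifield structure along: a multiplication that
    matches [P] through additive bijections inherits both distributive laws and
    the absence of zero divisors. *)
Lemma isotopic_transport (V W : finZmodType) (P : presemifield V)
    (M : W -> W -> W) (A B C : V -> W) :
    zmod_morphism A -> zmod_morphism B -> zmod_morphism C ->
    bijective A -> bijective B -> bijective C ->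
    (forall x y, M (A x) (B y) = C (P x y)) ->
  exists Q : presemifield W, (forall u v, Q u v = M u v) /\ isotopic P Q.
Proof.
move=> /zmod_morphism_bundled[A' AE] /zmod_morphism_bundled[B' BE].
move=> /zmod_morphism_bundled[C' CE].
move=> /(eq_bij)/(_ A')/(_ (fsym AE)) bijA /(eq_bij)/(_ B')/(_ (fsym BE)) bijB.
move=> /(eq_bij)/(_ C')/(_ (fsym CE)) bijC MP.
have{}MP x y : M (A' x) (B' y) = C' (P x y) by rewrite AE BE CE.
case: (bijA) (bijB) => [Ai AK AiK] [Bi BK BiK].
have ME u v : M u v = C' (P (Ai u) (Bi v)) by rewrite -MP AiK BiK.
have AiB := can2_zmod_morphism AK AiK; have BiB := can2_zmod_morphism BK BiK.
case: (zmod_morphism_bundled AiB) (zmod_morphism_bundled BiB) => [A1 A1E] [B1 B1E].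
have MDl : left_distributive M +%R.
  by move=> u v w; rewrite !ME -!A1E raddfD psmulDl raddfD.
have MDr : right_distributive M +%R.
  by move=> u v w; rewrite !ME -!B1E raddfD psmulDr raddfD.
have M0 u v : M u v = 0 -> u = 0 \/ v = 0.
  rewrite ME => /eqP; rewrite raddf_eq0; last exact: bij_inj.
  move=> /eqP/psmul_eq0[] E; [left | right].
    by rewrite -(AiK u) E raddf0.
  by rewrite -(BiK v) E raddf0.
by exists (Presemifield MDl MDr M0); split=> //; exists A', B', C'; split.
Qed.

(** The same with the bijections in the other direction, for use when the maps
    out of [W] are the ones given by a formula. *)
Lemma isotopic_transport_inv (V W : finZmodType) (P : presemifield V)
    (M : W -> W -> W) (A B C : W -> V) :
    zmod_morphism A -> zmod_morphism B -> zmod_morphism C ->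
    bijective A -> bijective B -> bijective C ->
    (forall u v, P (A u) (B v) = C (M u v)) ->
  exists Q : presemifield W, (forall u v, Q u v = M u v) /\ isotopic P Q.
Proof.
have inv f : zmod_morphism f -> bijective f ->
    exists g : V -> W, [/\ zmod_morphism g, bijective g, cancel f g & cancel g f].
  move=> /zmod_morphism_bundled[f' fE] [g fK gK]; exists g.
  have f'K : cancel f' g by move=> x; rewrite fE.
  have gf'K : cancel g f' by move=> x; rewrite fE.
  by split=> //; [exact: can2_zmod_morphism f'K gf'K | exists f].
move=> Aadd Badd Cadd /(inv A Aadd)[Ai [AiB bijA AK AiK]].
move=> /(inv B Badd)[Bi [BiB bijB BK BiK]] /(inv C Cadd)[Ci [CiB bijC CK CiK]] MP.
apply: isotopic_transport AiB BiB CiB bijA bijB bijC _ => x y.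
by apply: (can_inj CK); rewrite -MP AiK BiK CiK.
Qed.

(** * Squares in a finite field of odd order *)

Lemma finField_generator (K : finFieldType) :
  exists g : K, forall x, x != 0 -> exists i, x = g ^+ i.
Proof.
have /cyclicP[g gE] := field_unit_group_cyclic [set: {unit K}]%G.
exists (val g) => x x0.
have xU : x \is a GRing.unit by rewrite unitfE.
have : FinRing.unit K xU \in <[g]>%g by rewrite -gE inE.
by case/cycleP => i /(congr1 val); rewrite /= FinRing.val_unitX; exists i.
Qed.

Lemma is_power_div (K : finFieldType) k (x y : K) :
  is_power k x -> is_power k y -> is_power k (x / y).
Proof. by move=> [u ->] [v ->]; exists (u / v); rewrite expr_div_n. Qed.

Lemma nonsquare_neq0 (K : finFieldType) (x : K) : ~ is_power 2 x -> x != 0.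
Proof. by move=> xN; apply/eqP => x0; apply: xN; exists 0; rewrite x0 expr0n. Qed.

(** Both discrete logarithms are odd, so their sum is even. *)
Lemma nonsquare_mul (K : finFieldType) (x y : K) :
  ~ is_power 2 x -> ~ is_power 2 y -> is_power 2 (x * y).
Proof.
move=> xN yN; have [g gP] := finField_generator K.
have odd_log z : ~ is_power 2 z -> exists i, z = g ^+ (i.*2.+1).
  move=> zN; have [i zE] := gP z (nonsquare_neq0 zN).
  exists i./2; rewrite zE; have [iO|iE] := boolP (odd i).
    by rewrite -[in LHS](odd_double_half i) iO.
  by case: zN; exists (g ^+ i./2); rewrite zE -exprM muln2 even_halfK.
have [i ->] := odd_log x xN; have [j ->] := odd_log y yN.
by exists (g ^+ (i + j).+1); rewrite -exprD -exprM; congr (_ ^+ _); lia.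
Qed.

Lemma nonsquare_div (K : finFieldType) (x y : K) :
  ~ is_power 2 x -> ~ is_power 2 y -> is_power 2 (x / y).
Proof.
move=> xN yN; have y0 := nonsquare_neq0 yN.
have -> : x / y = x * y / y ^+ 2 by field.
by apply: is_power_div; [exact: nonsquare_mul | exists y].
Qed.

Lemma two_neq0 (K : finFieldType) p :
  odd p -> p \in [pchar K] -> (2%:R : K) != 0.
Proof.
move=> p_odd /[dup] /pcharf_prime p_pr pK.
rewrite -(dvdn_pcharf pK); apply/negP => /(dvdn_leq (ltn0Sn 1)).
by case: p p_odd p_pr {pK} => [|[|[|]]].
Qed.

(** The squares cannot be closed under [x |-> 1 + x]: otherwise every multiple
    of 1 would be a square, [-1 = p - 1] among them. *)
Lemma exists_nonsquare_succ_square (K : finFieldType) p :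
    p \in [pchar K] -> ~ is_power 2 (-1 : K) ->
  exists a : K, ~ is_power 2 (1 + a ^+ 2).
Proof.
move=> pK neg1N.
have [/forallP sq|] := boolP [forall a : K, [exists y, 1 + a ^+ 2 == y ^+ 2]].
  have nat_sq k : is_power 2 (k%:R : K).
    elim: k => [|k [y IH]]; first by exists 0; rewrite expr0n.
    rewrite -natr1 addrC IH.
    by case/existsP: (sq y) => z /eqP ->; exists z.
  case: neg1N; have -> : (-1 : K) = p.-1%:R; last exact: nat_sq.
  apply/eqP; rewrite eq_sym -addr_eq0 natr1 prednK ?prime_gt0 ?(pcharf_prime pK) //.
  by rewrite (pcharf0 pK).
rewrite negb_forall => /existsP[a /existsPn aN]; exists a => -[y yE].
by move: (aN y); rewrite yE eqxx.
Qed.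

Lemma neg1_nonsquare (K : finFieldType) :
  (2%:R : K) != 0 -> (#|K| %% 4 = 3)%N -> ~ is_power 2 (-1 : K).
Proof.
move=> K2 K3 [y yE]; have y0 : y != 0.
  by apply: contra_eq_neq yE => ->; rewrite expr0n oppr_eq0 oner_neq0.
have y1 : y ^+ (#|K|.-1) = 1.
  by apply: (mulfI y0); rewrite -exprS prednK ?expf_card ?mulr1 //; lia.
move: y1; have -> : #|K|.-1 = (2 * (#|K| %/ 4).*2.+1)%N by lia.
rewrite exprM -yE exprS -mul2n exprM sqrrN !expr1n mulr1 => /eqP.
by rewrite eq_sym -addr_eq0 -mulr2n (negbTE K2).
Qed.

(** * Common divisors of [p^s + 1] and [p^m + 1] *)

Local Close Scope ring_scope.

(** Dividing by [gcd(s,m)] reduces to coprime [m'] and [s'], where the condition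
    becomes [gcd(m' + s', 2 m') = 1]. *)
Lemma gcd_cond_parity s m :
    (0 < s)%N -> (0 < m)%N -> gcdn (m + s) (2 * m) = gcdn (m + s) m ->
  odd (m %/ gcdn s m + s %/ gcdn s m).
Proof.
move=> s0 m0; set g := gcdn s m => gE.
have g0 : (0 < g)%N by rewrite gcdn_gt0 s0.
have [m' mE] := dvdnP (dvdn_gcdr s m : g %| m)%N.
have [s' sE] := dvdnP (dvdn_gcdl s m : g %| s)%N.
rewrite {1}mE {1}sE !mulnK //.
have co : gcdn (m' + s') m' = 1%N.
  rewrite gcdnC gcdnDl gcdnC; apply/eqP.
  by rewrite -(eqn_pmul2r g0) muln_gcdl -sE -mE mul1n.
move: gE; rewrite {1 2 3 4}mE {1 2}sE mulnA -mulnDl -!muln_gcdl co mul1n.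
move/eqP; rewrite -[X in _ == X]mul1n eqn_pmul2r // => /eqP g1.
apply/negPn/negP; rewrite -dvdn2 => even_sum.
by have : 2 %| 1 by rewrite -[X in _ %| X]g1 dvdn_gcd even_sum dvdn_mulr.
Qed.

(** This is [x = -1 mod d  ->  x^k = (-1)^k mod d], in natural numbers. *)
Lemma dvdn_expn_pm1 d x k : (0 < x)%N -> d %| x + 1 ->
  d %| (if odd k then x ^ k + 1 else x ^ k - 1).
Proof.
move=> x0 dx.
have even_case j : d %| x ^ j.*2 - 1.
  rewrite -mul2n expnM subn1 predn_exp dvdn_mulr // -subn1.
  by rewrite -[1%N in X in _ %| X](exp1n 2) subn_sqr dvdn_mull.
have [kO|kE] := boolP (odd k); last by rewrite -(even_halfK kE) even_case.
rewrite -{1}(odd_double_half k) kO.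
have -> : x ^ (1 + k./2.*2) + 1 = x * (x ^ k./2.*2 - 1) + (x + 1).
  rewrite expnD expn1; have : 0 < x ^ k./2.*2 by rewrite expn_gt0 x0.
  by case: (x ^ _) => // y _; rewrite subn1 /=; lia.
by rewrite dvdn_addl // dvdn_mull.
Qed.

(** Raising [p^s = -1] and [p^m = -1] to the powers [m / gcd(s,m)] and
    [s / gcd(s,m)] gives the same number with opposite signs, modulo any common
    divisor. *)
Lemma gcd_expn_succ p s m :
    odd p -> odd (m %/ gcdn s m + s %/ gcdn s m) ->
  gcdn (p ^ s + 1) (p ^ m + 1) = 2.
Proof.
move=> p_odd; set g := gcdn s m; set d := gcdn _ _ => par.
have p0 : (0 < p)%N by exact: odd_gt0.
have even1 k : 2 %| p ^ k + 1 by rewrite dvdn2 oddD oddX p_odd orbT.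
have d2 : 2 %| d by rewrite dvdn_gcd !even1.
apply/eqP; rewrite eqn_dvd d2 andbT.
have eE : ((p ^ s) ^ (m %/ g) = (p ^ m) ^ (s %/ g))%N.
  rewrite -!expnM; congr (_ ^ _)%N.
  by rewrite muln_divA ?dvdn_gcdr // mulnC -muln_divA ?dvdn_gcdl.
have := @dvdn_expn_pm1 d (p ^ s) (m %/ g);
  rewrite expn_gt0 p0 dvdn_gcdl => /(_ isT isT).
have := @dvdn_expn_pm1 d (p ^ m) (s %/ g);
  rewrite expn_gt0 p0 dvdn_gcdr => /(_ isT isT).
rewrite eE; move: par; rewrite oddD.
have : (0 < (p ^ m) ^ (s %/ g))%N by rewrite !expn_gt0 p0.
set X := ((p ^ m) ^ _)%N => X0.
have -> : 2%N = (X + 1) - (X - 1) by lia.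
by case: (odd _); case: (odd _) => //= _ ? ?; rewrite dvdn_sub.
Qed.

(** Here [(p^m + 1)/2] is odd. *)
Lemma first_BH_gcd p s m :
    gcdn (p ^ s + 1) (p ^ m + 1) = 2 -> (p ^ m) %% 4 = 1 ->
  gcdn (p ^ s + 1) (p ^ m + 1) <> gcdn (p ^ s + 1) ((p ^ m + 1) %/ 2).
Proof.
move=> -> q1 gE; have : 2 %| (p ^ m + 1) %/ 2 by rewrite [X in X %| _]gE dvdn_gcdr.
by lia.
Qed.

Local Open Scope ring_scope.

(** * Frobenius maps and conjugation *)

Section Frobenius.

Variables (K : finFieldType) (p : nat).
Hypothesis pK : p \in [pchar K].

Lemma frobD k (x y : K) : (x + y) ^+ (p ^ k) = x ^+ (p ^ k) + y ^+ (p ^ k).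
Proof.
apply: exprDn_pchar; rewrite (eq_pnat _ (pcharf_eq pK)).
by rewrite pnatX pnat_id ?(pcharf_prime pK).
Qed.

Lemma frobN k (x : K) : (- x) ^+ (p ^ k) = - x ^+ (p ^ k).
Proof.
apply/eqP; rewrite -addr_eq0 -frobD addNr expr0n expn_eq0.
by rewrite (gtn_eqF (prime_gt0 (pcharf_prime pK))).
Qed.

End Frobenius.

(** This is the polar form of [x |-> x^(sigma+1)]. *)
Definition sigma_form (K : finFieldType) p s (x y : K) : K :=
  x ^+ (p ^ s) * y + x * y ^+ (p ^ s).

Lemma polarization_sigma (K : finFieldType) p s (b x y : K) :
    p \in [pchar K] ->
  (b * (x + y)) ^+ (p ^ s + 1) =
    (b * x) ^+ (p ^ s + 1) + (b * y) ^+ (p ^ s + 1)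
    + b ^+ (p ^ s + 1) * sigma_form p s x y.
Proof.
by move=> pK; rewrite /sigma_form !addn1 !exprSr !exprMn (frobD pK); ring.
Qed.

(** For a planar [f], the difference map in direction [a] is the translate by
    [f a] of multiplication by [a]; it is injective when there are no zero
    divisors. *)
Lemma presemifield_planar (K : finFieldType) (f : K -> K) (Q : presemifield K) :
  (forall x y, Q x y = polarization f x y) -> planar f.
Proof.
move=> QE a a0; apply: injF_bij => x y /eqP E.
have Qxy : Q x a = Q y a.
  by rewrite !QE /polarization; congr (_ - _); apply/eqP.
have : Q (x - y) a = 0.
  apply/eqP; have := psmulDl Q (x - y) y a; rewrite subrK Qxy => /eqP.
  by rewrite -subr_eq0 opprD addrCA subrr addr0 oppr_eq0.
by case/psmul_eq0 => [/eqP|/eqP]; rewrite ?subr_eq0 ?(negbTE a0) // => /eqP.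
Qed.

Section Conjugation.

Variables (p m : nat) (L F : finFieldType) (iota : {rmorphism L -> F}).
Hypotheses (p_prime : prime p) (cardL : #|L| = (p ^ m)%N).
Hypothesis (cardF : #|F| = (p ^ (2 * m))%N).

Local Notation conj := (@conjF p m F).

Let pF : p \in [pchar F]. Proof. exact: card_finPcharP cardF p_prime. Qed.

Lemma conjD x y : conj (x + y) = conj x + conj y.
Proof. exact: frobD. Qed.

Lemma conjN x : conj (- x) = - conj x.
Proof. exact: frobN. Qed.

Lemma conjB x y : conj (x - y) = conj x - conj y.
Proof. by rewrite conjD conjN. Qed.

Lemma conjM x y : conj (x * y) = conj x * conj y.
Proof. exact: exprMn. Qed.

Lemma conjV x : conj x^-1 = (conj x)^-1.
Proof. exact: exprVn. Qed.

Lemma conjX x k : conj (x ^+ k) = conj x ^+ k.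
Proof. exact: exprAC. Qed.

Lemma conj0 : conj 0 = 0.
Proof. by rewrite -{1}(subrr 0) conjB subrr. Qed.

Lemma conjK x : conj (conj x) = x.
Proof. by rewrite /conjF -exprM -expnD addnn -mul2n -cardF expf_card. Qed.

Lemma conj_iota z : conj (iota z) = iota z.
Proof. by rewrite /conjF -rmorphXn -cardL expf_card. Qed.

(** The polynomial ['X^(p ^ m) - 'X] splits over [L] as the product of all the
    ['X - z], so it has no other root in [F]. *)
Lemma conj_fixed x : conj x = x -> exists z, x = iota z.
Proof.
move=> xfix; have /(congr1 (map_poly iota)) := finField_genPoly L.
rewrite rmorph_prod rmorphB /= map_polyXn map_polyX cardL.
move/(congr1 (horner^~ x)); rewrite horner_prod !hornerE -/(conj x) xfix subrr.
move=> /esym/eqP/prodf_eq0[z _]; rewrite map_polyXsubC !hornerE subr_eq0.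
by move/eqP; exists z.
Qed.

(** This is the polar form of the norm [x |-> x conj(x)]. *)
Definition norm_form (x y : F) : F := x * conj y + conj x * y.

Definition frob_poly (c : 'I_m -> L) (x : F) : F :=
  \sum_(i < m) iota (c i) * x ^+ (p ^ i).

Lemma conj_norm_form x y : conj (norm_form x y) = norm_form x y.
Proof. by rewrite /norm_form conjD !conjM !conjK; ring. Qed.

Lemma frob_polyD c x y : frob_poly c (x + y) = frob_poly c x + frob_poly c y.
Proof.
by rewrite -big_split /=; apply: eq_bigr => i _; rewrite (frobD pF) mulrDr.
Qed.

Lemma frob_polyN c x : frob_poly c (- x) = - frob_poly c x.
Proof.
by rewrite -sumrN; apply: eq_bigr => i _; rewrite (frobN pF) mulrN.
Qed.

Lemma frob_polyB c x y : frob_poly c (x - y) = frob_poly c x - frob_poly c y.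
Proof. by rewrite frob_polyD frob_polyN. Qed.

Lemma frob_poly0 c : frob_poly c 0 = 0.
Proof. by rewrite -{1}(subrr 0) frob_polyB subrr. Qed.

Lemma conj_frob_poly c x : conj x = x -> conj (frob_poly c x) = frob_poly c x.
Proof.
move=> xfix; have -> :
    conj (frob_poly c x) = \sum_(i < m) conj (iota (c i) * x ^+ (p ^ i)).
  rewrite /frob_poly; elim/big_rec2: _ => [|i y z _ <-]; first exact: conj0.
  by rewrite conjD.
by apply: eq_bigr => i _; rewrite conjM conjX conj_iota xfix.
Qed.

Lemma norm_formD x y :
  (x + y) * conj (x + y) = x * conj x + y * conj y + norm_form x y.
Proof. by rewrite conjD /norm_form; ring. Qed.

Lemma polarization_bh1 s b c x y :
  polarization (bh1_fun p iota s b c) x y =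
    b ^+ (p ^ s + 1) * sigma_form p s x y
    - conj (b ^+ (p ^ s + 1) * sigma_form p s x y) + frob_poly c (norm_form x y).
Proof.
rewrite /polarization /bh1_fun -!/(frob_poly c _) norm_formD !frob_polyD.
by rewrite (polarization_sigma _ _ _ _ pF) !conjD; ring.
Qed.

Lemma polarization_bh2 s beta gamma r x y :
  polarization (bh2_fun p iota s beta gamma r) x y =
    trF p m (beta * sigma_form p s x y)
    + gamma * norm_form x y + frob_poly r (norm_form x y).
Proof.
rewrite /polarization /bh2_fun /trF -!/(frob_poly r _) norm_formD !frob_polyD.
have := polarization_sigma s 1 x y pF; rewrite !mul1r expr1n mul1r => ->.
by rewrite !mulrDr !conjD; ring.
Qed.

(** If [y ^+ 2 = z], a Bezout relation [2 = (p^s+1) k - (p^m+1) j] writes [z] as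
    a [(p^s+1)]-th power times a norm. *)
Lemma square_decomposition s z :
    gcdn (p ^ s + 1) (p ^ m + 1) = 2%N -> is_power 2 z -> z != 0 ->
  exists lam u : F, [/\ conj lam = lam, lam != 0, u != 0 & z = lam * u ^+ (p ^ s + 1)].
Proof.
move=> gcd2 [y zE] z0; have y0 : y != 0.
  by apply: contra_neq z0; rewrite zE => ->; rewrite expr0n.
have : (0 < p ^ s + 1)%N by rewrite addn1.
case/(egcdnP (p ^ m + 1)) => k j /=; rewrite gcd2 => kE _.
exists ((y^-1) ^+ j ^+ (p ^ m + 1)), (y ^+ k); split; rewrite ?expf_neq0 ?invr_eq0 //.
  by rewrite addn1 exprSr conjM conjX -/(conj _) conjK mulrC.
by rewrite -!exprM kE exprD mulrA [(j * _)%N]mulnC -exprMn mulVf // expr1n mul1r.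
Qed.

(** * The two isotopisms *)

Definition delta0 (i : 'I_m) : L := (i == 0 :> nat)%:R.

(** In the form needed both for coefficients in [L] and, through [iota], in [F]:
    [delta0] gives the identity among the additive polynomials. *)
Lemma frob_poly_delta0 (K : nzRingType) (f : {rmorphism L -> K}) (x : K) :
  (0 < m)%N -> \sum_(i < m) f (delta0 i) * x ^+ (p ^ i) = x.
Proof.
move=> m0; rewrite (bigD1 (Ordinal m0)) //= /delta0 eqxx rmorph1 mul1r expr1.
rewrite big1 ?addr0 // => i i0.
by rewrite (_ : (i == 0 :> nat) = false) ?rmorph0 ?mul0r //; apply: negbTE.
Qed.

(** With [beta = omega lam u^(sigma+1)] and [conj omega = - omega], the trace of
    [beta {x,y}] is [omega lam (z - conj z)] for [z = u^(sigma+1) {x,y}], and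
    [z - conj z] is what the first family uses.  So the identity works as both
    substitutions, and only the values have to be rearranged. *)
Lemma bh2_isotopic_bh1 s beta gamma (r : 'I_m -> L) omega lam u (P : presemifield F) :
    (0 < m)%N -> (2%:R : F) != 0 ->
    conj omega = - omega -> omega != 0 -> conj lam = lam -> lam != 0 ->
    beta = omega * (lam * u ^+ (p ^ s + 1)) ->
    ~ (exists z : L, gamma = iota z) ->
    (forall x y, P x y = polarization (bh2_fun p iota s beta gamma r) x y) ->
  exists Q : presemifield F,
    (forall x y, Q x y = polarization (bh1_fun p iota s u delta0) x y)
    /\ isotopic P Q.
Proof.
move=> m0 F2 omegaN omega0 lamE lam0 betaE gammaN PE.
have dgamma0 : gamma - conj gamma != 0.
  by apply/eqP => /eqP; rewrite subr_eq0 => /eqP/esym/conj_fixed.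
(* Every [z] is uniquely [tau + gamma nu + phi nu] with [tau], [nu] in [L]; on
   products, [nu] is the norm form and [tau] the trace term. *)
pose nu z := (z - conj z) / (gamma - conj gamma).
pose tau z := z - gamma * nu z - frob_poly r (nu z).
pose C z := tau z / (omega * lam) + nu z.
have nuB x y : nu (x - y) = nu x - nu y.
  by rewrite /nu conjB -mulrBl; congr (_ / _); ring.
have tauB x y : tau (x - y) = tau x - tau y.
  by rewrite /tau nuB frob_polyB; ring.
have CB : zmod_morphism C by move=> x y; rewrite /C tauB nuB; ring.
have conj_nu z : conj (nu z) = nu z.
  rewrite /nu conjM conjV !conjB !conjK -(opprB z) -(opprB gamma).
  by rewrite invrN mulrNN.
have conj_tau z : conj (tau z) = tau z.
  have conjE : conj z = z - (gamma - conj gamma) * nu z by rewrite /nu; field.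
  by rewrite /tau !conjB conjM conj_nu conj_frob_poly // conjE; ring.
(* The two terms of [C z] are anti-invariant and invariant under [conj], so they
   vanish together. *)
have C0 z : C z = 0 -> z = 0.
  move=> Cz; have Cz' : - (tau z / (omega * lam)) + nu z = 0.
    rewrite -[RHS]conj0 -Cz /C conjD conj_nu conjM conj_tau conjV conjM.
    by rewrite omegaN lamE mulNr invrN mulrN.
  have nu0 : nu z = 0.
    apply/eqP; rewrite -(mulrI_eq0 _ (mulfI F2)); apply/eqP.
    by rewrite -[RHS](addr0 0) -{1}Cz -Cz' /C; ring.
  have tau0 : tau z = 0.
    move/eqP: Cz; rewrite /C nu0 addr0 mulf_eq0 invr_eq0 mulf_eq0.
    by rewrite (negbTE omega0) (negbTE lam0) !orbF => /eqP.
  by rewrite -tau0 /tau nu0 mulr0 frob_poly0 !subr0.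
have bijC : bijective C by apply/injF_bij/zmod_morphism_inj.
have bij_id : bijective (@id F) by exists id.
have id_add : zmod_morphism (@id F) by [].
apply: (isotopic_transport id_add id_add CB bij_id bij_id bijC) => x y /=.
rewrite polarization_bh1 PE polarization_bh2 /frob_poly frob_poly_delta0 //.
rewrite -/(frob_poly r _).
move: (norm_form x y) (conj_norm_form x y) (sigma_form _ _ _ _) => n nE S.
have nuE t : conj t = t -> nu (t + gamma * n + frob_poly r n) = n.
  move=> tE; rewrite /nu 2!conjD conjM tE nE conj_frob_poly //.
  by field.
have trE : conj (trF p m (beta * S)) = trF p m (beta * S).
  by rewrite /trF conjD conjK addrC.
rewrite /C /tau nuE //; congr (_ + _).
rewrite (_ : _ - frob_poly r n = trF p m (beta * S)); last by ring.
rewrite /trF betaE !conjM omegaN lamE.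
by field; rewrite lam0.
Qed.

(** The scalar [v] relates [l] to [N]: replacing a factor [(c,d)] by [v (c,d)]
    multiplies the terms of [B_h] in [c^sigma, d^sigma] by [v^sigma] and those
    in [c, d] by [v], so that [l = N v^(sigma-1)] may be traded for [l = N].
    With [l = N], the product of [(a,b)] and [(- n d, c)] is symmetric in [(a,b)]
    and [(c,d)], and it is the polar form of the pair of
    [a^(sigma+1) + n N b^(sigma+1) - (a^sigma b + N a b^sigma)] and
    [(a^2 - n b^2)/2], up to the factor [n N] in the first entry.  For
    [x = a + theta b] these are [Tr ((1 - theta/n) x^(sigma+1))/2] and
    [x conj(x)/2]. *)
Lemma bh2_isotopic_B s beta gamma (r : 'I_m -> L) theta
    (n N l v : L) (lam u : F) (P : presemifield F) :
    (2%:R : F) != 0 -> n != 0 -> N != 0 -> v != 0 -> u != 0 ->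
    theta ^+ 2 = iota n -> conj theta = - theta ->
    theta ^+ (p ^ s) = iota N * theta -> l * v = N * v ^+ (p ^ s) ->
    conj lam = lam -> lam != 0 ->
    beta * u ^+ (p ^ s + 1) = lam * (1 - theta / iota n) ->
    ~ (exists z : L, gamma = iota z) ->
    (forall x y, P x y = polarization (bh2_fun p iota s beta gamma r) x y) ->
  exists Q : presemifield (L * L)%type,
    (forall x y, Q x y = B_mul p s l n N x y) /\ isotopic P Q.
Proof.
move=> F2 n0 N0 v0 u0 theta2 thetaN thetaS lE lamE lam0 betaE gammaN PE.
have in0 : iota n != 0 by rewrite fmorph_eq0.
have iN0 : iota N != 0 by rewrite fmorph_eq0.
have iv0 : iota v != 0 by rewrite fmorph_eq0.
have theta0 : theta != 0 by move: in0; rewrite -theta2 expf_eq0.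
have nS : iota n ^+ (p ^ s) = iota n * iota N ^+ 2.
  by rewrite -theta2 -exprM mulnC exprM thetaS exprMn mulrC.
have twist0 a b : iota a + theta * iota b = 0 -> a = 0 /\ b = 0.
  move=> E; have E' : iota a - theta * iota b = 0.
    by rewrite -[RHS]conj0 -E conjD conjM thetaN !conj_iota mulNr.
  have /eqP : 2%:R * iota a = 0 by rewrite -[RHS](addr0 0) -{1}E -E'; ring.
  rewrite mulf_eq0 (negbTE F2) fmorph_eq0 /= => /eqP a0; split=> //.
  move/eqP: E; rewrite a0 rmorph0 add0r mulf_eq0 (negbTE theta0) fmorph_eq0.
  by move/eqP.
(* [A] is the coordinate map of [F] for the basis [u, u theta]; [B] is the same
   map after the exchange [(c,d) |-> (d, - c/n)] and the division by [v]. *)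
pose A (w : L * L) := u * (iota w.1 + theta * iota w.2).
pose B (w : L * L) := u / iota v * (iota w.2 - theta * iota w.1 / iota n).
pose kappa := 2%:R * (u * conj u) / iota v.
pose mu := 2%:R * lam / (iota (v ^+ (p ^ s)) * (iota n * iota N)).
pose C (w : L * L) := mu * iota w.1 + gamma * (kappa * iota w.2)
  + frob_poly r (kappa * iota w.2).
have cu0 : conj u != 0 by exact: expf_neq0.
have vS0 : v ^+ (p ^ s) != 0 by exact: expf_neq0.
have ivS0 : iota (v ^+ (p ^ s)) != 0 by rewrite fmorph_eq0.
have kappa0 : kappa != 0 by rewrite /kappa !mulf_neq0 // invr_eq0.
have mu0 : mu != 0 by rewrite /mu !mulf_neq0 // invr_eq0 !mulf_neq0.
have conj2 : conj 2%:R = 2%:R by rewrite -(rmorph_nat iota) conj_iota.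
have kappaE : conj kappa = kappa.
  by rewrite /kappa !conjM conj2 conjK conjV conj_iota; ring.
have muE : conj mu = mu.
  by rewrite /mu !conjM conj2 lamE conjV !conjM !conj_iota.
have AB : zmod_morphism A.
  by move=> x y; rewrite /A /= !rmorphB; ring.
have BB : zmod_morphism B.
  by move=> x y; rewrite /B /= !rmorphB; ring.
have CB : zmod_morphism C.
  by move=> x y; rewrite /C /= !rmorphB !mulrBr frob_polyB; ring.
have cardW : (#|F| <= #|{: L * L}|)%N.
  by rewrite card_prod cardL cardF -expnD addnn mul2n.
have bijA : bijective A.
  apply: inj_card_bij cardW; apply: zmod_morphism_inj => // -[a b] /eqP.
  by rewrite mulf_eq0 (negbTE u0) /= => /eqP/twist0[-> ->].
have bijB : bijective B.
  apply: inj_card_bij cardW; apply: zmod_morphism_inj => // -[a b] /eqP.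
  rewrite !mulf_eq0 invr_eq0 (negbTE u0) (negbTE iv0) /= => /eqP E.
  have /twist0[-> /eqP] : iota b + theta * iota (- a / n) = 0.
    by rewrite fmorph_div rmorphN -E; ring.
  by rewrite mulf_eq0 invr_eq0 (negbTE n0) orbF oppr_eq0 => /eqP ->.
have bijC : bijective C.
  apply: inj_card_bij cardW; apply: zmod_morphism_inj => // -[h k] E.
  have conjh : conj (mu * iota h) = mu * iota h by rewrite conjM muE conj_iota.
  have conjk : conj (kappa * iota k) = kappa * iota k.
    by rewrite conjM kappaE conj_iota.
  (* If [k] were nonzero, [gamma] would be a quotient of elements of [L]. *)
  have k0 : k = 0.
    apply/eqP/negPn/negP => k0; apply: gammaN; apply: conj_fixed.
    have kk0 : kappa * iota k != 0 by rewrite mulf_neq0 ?fmorph_eq0.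
    apply: (mulIf kk0); apply: (addrI (mu * iota h)).
    apply: (addIr (frob_poly r (kappa * iota k))); rewrite [RHS]E.
    rewrite -[RHS]conj0 -E /C /= [in RHS]conjD [in RHS]conjD conjh.
    by rewrite (conjM gamma) conjk conj_frob_poly.
  move: E; rewrite /C /= k0 rmorph0 !mulr0 frob_poly0 !addr0 => /eqP.
  by rewrite mulf_eq0 (negbTE mu0) fmorph_eq0 => /eqP ->.
apply: (isotopic_transport_inv AB BB CB bijA bijB bijC) => -[a b] [c d].
rewrite PE polarization_bh2 /C.
have -> : norm_form (A (a, b)) (B (c, d)) = kappa * iota (a * d + b * c).
  rewrite /norm_form /A /B /kappa /= !(conjM, conjB, conjD, conjV) thetaN !conj_iota.
  rewrite rmorphD !rmorphM -theta2.
  by field; rewrite theta0 iv0.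
congr (_ + _ + _).
have trUV U V : conj U = U -> conj V = V ->
    trF p m (lam * (1 - theta / iota n) * (U + theta * V)) = 2%:R * lam * (U - V).
  have conj1 : conj 1 = 1 by rewrite -(rmorph1 iota) conj_iota.
  move=> UE VE; rewrite /trF !(conjM, conjB, conjD, conjV) UE VE thetaN lamE.
  by rewrite conj_iota conj1 -theta2; field.
(* [U + theta V] is the decomposition of [sigma_form (A (a, b)) (B (c, d))] over
   [L], up to the factor [u^(sigma+1)]. *)
pose U := (iota a ^+ (p ^ s) * iota d - iota N * iota b ^+ (p ^ s) * iota c) / iota v
  + (iota a * iota d ^+ (p ^ s) - iota b * iota c ^+ (p ^ s) / iota N)
    / iota (v ^+ (p ^ s)).
pose V := (iota N * iota b ^+ (p ^ s) * iota d
           - iota a ^+ (p ^ s) * iota c / iota n) / iota v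
  + (iota b * iota d ^+ (p ^ s) - iota a * iota c ^+ (p ^ s) / (iota n * iota N))
    / iota (v ^+ (p ^ s)).
have -> : beta * sigma_form p s (A (a, b)) (B (c, d))
    = lam * (1 - theta / iota n) * (U + theta * V).
  rewrite -betaE addn1 exprSr /sigma_form /A /B /= !exprMn exprVn.
  rewrite !(frobD pF) !(frobN pF) !exprMn exprVn thetaS nS /U /V -theta2.
  move: ivS0; rewrite !rmorphXn /=.
  move: (iota v ^+ (p ^ s)) (iota a ^+ (p ^ s)) (iota b ^+ (p ^ s)).
  move: (iota c ^+ (p ^ s)) (iota d ^+ (p ^ s)) (u ^+ (p ^ s)).
  move=> us ds cs bs a_s vs vs0.
  by field; rewrite theta0 iv0 iN0 vs0.
have conjU : conj U = U.
  by rewrite /U !(conjM, conjB, conjD, conjV, conjX, conj_iota).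
have conjV' : conj V = V.
  by rewrite /V !(conjM, conjB, conjD, conjV, conjX, conj_iota).
rewrite trUV // /B_mul /B_h /mu /U /V /=.
have -> : l = N * v ^+ (p ^ s) / v by rewrite -lE mulfK.
rewrite !(rmorphB, rmorphD, rmorphM, fmorphV, rmorphXn) /= -theta2.
move: ivS0; rewrite rmorphXn /=.
move: (iota v ^+ (p ^ s)) (iota a ^+ (p ^ s)) (iota b ^+ (p ^ s)).
move: (iota c ^+ (p ^ s)) (iota d ^+ (p ^ s)) => ds cs bs a_s vs vs0.
by field; rewrite theta0 iv0 iN0 vs0.
Qed.

(** * Elements of trace zero *)

(** A square root of [w] in [L] would be [omega] or [- omega], and neither is
    fixed by [conj]. *)
Lemma trace0_square (omega : F) : (2%:R : F) != 0 -> omega != 0 ->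
    conj omega = - omega -> exists2 w, iota w = omega ^+ 2 & ~ is_power 2 w.
Proof.
move=> F2 omega0 omegaN.
have [w wE] : exists w, omega ^+ 2 = iota w.
  by apply: conj_fixed; rewrite conjX omegaN sqrrN.
exists w => // -[z zE].
have /eqP : omega ^+ 2 = iota z ^+ 2 by rewrite wE zE rmorphXn.
rewrite eqf_sqr => /orP[] /eqP oE.
  move: omegaN; rewrite {1}oE conj_iota -oE => /eqP.
  by rewrite -addr_eq0 -mulr2n -mulr_natl mulf_eq0 (negbTE F2) (negbTE omega0).
move: omegaN; rewrite {1}oE conjN conj_iota -oE => /eqP.
by rewrite -addr_eq0 -mulr2n -mulr_natl mulf_eq0 (negbTE F2) (negbTE omega0).
Qed.

(** If [omega = y^2], then [y^(q^2-1) = omega^((q-1)(q+1)/2) = (-1)^((q+1)/2)],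
    which is [-1] because [(q+1)/2] is odd. *)
Lemma trace0_nonsquare (omega : F) : (2%:R : F) != 0 -> omega != 0 ->
    conj omega = - omega -> (p ^ m %% 4 = 1)%N -> ~ is_power 2 omega.
Proof.
clear pF p_prime cardL.
move=> F2 omega0 omegaN q1 [y yE].
have y0 : y != 0 by apply: contra_neq omega0; rewrite yE => ->; rewrite expr0n.
have : y ^+ (p ^ (2 * m)) = y by rewrite -cardF expf_card.
have qO : odd ((p ^ m + 1)./2)%N by lia.
have omega_q : omega ^+ (p ^ m - 1)%N = -1.
  apply: (mulfI omega0); rewrite -exprS mulrN1 -omegaN; congr (_ ^+ _); lia.
have -> : (p ^ (2 * m) = (2 * ((p ^ m - 1) * (p ^ m + 1)./2)).+1)%N.
  rewrite mul2n -addnn expnD.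
  have [j ->] : exists j, (p ^ m = 2 * j + 1)%N by exists (p ^ m)./2; lia.
  by rewrite addnK (_ : (2 * j + 1 + 1)./2 = j + 1)%N; lia.
rewrite exprS exprM -yE exprM omega_q -signr_odd qO expr1 mulrN1 => /eqP.
by rewrite eq_sym -addr_eq0 -mulr2n -mulr_natl mulf_eq0 (negbTE F2) (negbTE y0).
Qed.

End Conjugation.

(** * Parameter conditions from the absence of zero divisors *)

Section AbsenceOfZeroDivisors.

Variables (p s : nat) (L : finFieldType) (l n N : L).
Hypotheses (p_odd : odd p) (pL : p \in [pchar L]).
Hypotheses (l0 : l != 0) (n0 : n != 0) (N0 : N != 0).
Hypothesis nS : n ^+ (p ^ s) = n * N ^+ 2.

(** Both conditions exclude explicit zero divisors.  If [- l = y^(sigma-1)], then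
    [(1,0) * (y,0) = (y^sigma + l y, 0)] vanishes.  And the product of
    [(n (1 + x), 1)] and [(n (1 + x), -1)] has second entry 0, and first entry a
    multiple of the polynomial at [x]. *)
Lemma presemifield_B_cond (Q : presemifield (L * L)%type) :
  (0 < s)%N -> (forall u v, Q u v = B_mul p s l n N u v) -> B_cond p s l n N.
Proof.
move=> s0 QE; have nz w z : w != 0 -> z != 0 -> B_mul p s l n N w z != 0.
  move=> w0 z0; rewrite -QE; apply/eqP => /psmul_eq0[]; exact/eqP.
have ps0 : (0 < p ^ s)%N by rewrite expn_gt0 odd_gt0.
have ps1 : (0 < p ^ s - 1)%N.
  by rewrite subn_gt0 -(exp1n s) ltn_exp2r // prime_gt1 ?(pcharf_prime pL).
have zeroS : (0 : L) ^+ (p ^ s) = 0 by rewrite expr0n gtn_eqF.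
split=> //.
  move=> [y yE]; have y0 : y != 0.
    apply: contra_eq_neq yE => ->.
    by rewrite expr0n gtn_eqF // oppr_eq0.
  have w0 : ((1, 0) : L * L) != 0 by rewrite xpair_eqE oner_eq0.
  have z0 : ((y, 0) : L * L) != 0 by rewrite xpair_eqE (negbTE y0).
  have /eqP[] := nz _ _ w0 z0.
  have yS : y ^+ (p ^ s) = - l * y by rewrite yE -exprSr; congr (_ ^+ _); lia.
  rewrite /B_mul /B_h /= zeroS expr1n yS; congr (_, _); ring.
move=> x; apply/eqP => xE.
have w0 : ((n * (1 + x), 1) : L * L) != 0.
  by rewrite xpair_eqE oner_eq0 andbF.
have z0 : ((n * (1 + x), -1) : L * L) != 0.
  by rewrite xpair_eqE oppr_eq0 oner_eq0 andbF.
have /eqP[] := nz _ _ w0 z0.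
rewrite /B_mul /B_h /= exprMn (frobN pL) (frobD pL) nS !expr1n.
congr (_, _); last by ring.
transitivity ((1 + l) * (n * N) ^+ 2
   * (x ^+ (p ^ s + 1) + (1 - N^-1) * x + (n^-1 - 1) / N)).
  rewrite exprD expr1; move: (x ^+ (p ^ s)) => xs.
  by field; rewrite n0 N0.
by rewrite xE mulr0.
Qed.

End AbsenceOfZeroDivisors.

(** * Inclusion of the second family *)

Theorem proposition7p16 (p m : nat) (L F : finFieldType)
    (iota : {rmorphism L -> F}) (omega : F)
    (p_prime : prime p) (p_odd : odd p)
    (cardL : #|L| = (p ^ m)%N) (cardF : #|F| = (p ^ (2 * m))%N)
    (omega_neq0 : omega != 0) (omega_tr0 : trF p m omega = 0)
    (P : presemifield F) (P_BH2 : second_BH_family p m iota P) :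
  (exists Q : presemifield F, first_BH_family p m iota Q /\ isotopic P Q) \/
  (exists Q : presemifield (L * L)%type,
     B_family p m iota omega Q /\ isotopic P Q).
Proof.
have pL : p \in [pchar L] := card_finPcharP cardL p_prime.
have pF : p \in [pchar F] := card_finPcharP cardF p_prime.
have F2 := two_neq0 p_odd pF.
have omegaN : conjF p m omega = - omega.
  by apply/eqP; rewrite -addr_eq0 addrC; apply/eqP.
case: P_BH2 => s [beta [gamma [r [[sm betaN gammaN gcdE] _ PE]]]].
have [s0 s_lt_m] := andP sm; have m0 := ltn_trans s0 s_lt_m.
have par := gcd_cond_parity s0 m0 gcdE; have gcd2 := gcd_expn_succ p_odd par.
have q_odd : odd (p ^ m) by rewrite oddX p_odd orbT.
have [q1|q3] : (p ^ m %% 4 = 1 \/ p ^ m %% 4 = 3)%N by lia.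
  left; have omega_nsq := trace0_nonsquare cardF F2 omega_neq0 omegaN q1.
  have [lam [u [lamE lam0 u0 zE]]] : exists lam u, [/\ conjF p m lam = lam,
      lam != 0, u != 0 & beta / omega = lam * u ^+ (p ^ s + 1)].
    apply: (square_decomposition cardF gcd2 (nonsquare_div betaN omega_nsq)).
    by rewrite mulf_neq0 ?invr_eq0 // nonsquare_neq0.
  have betaE : beta = omega * (lam * u ^+ (p ^ s + 1)).
    by rewrite -zE mulrC divfK.
  have [Q [QE isoQ]] := bh2_isotopic_bh1 p_prime cardL cardF m0 F2 omegaN
    omega_neq0 lamE lam0 betaE gammaN PE.
  exists Q; split=> //; exists s, u, (delta0 L); split=> //; last first.
    exact: presemifield_planar QE.
  split=> //; last exact: first_BH_gcd.
  by exists id => y; exact: (frob_poly_delta0 p idfun y m0).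
right; have neg1N : ~ is_power 2 (-1 : L).
  by apply: (neg1_nonsquare (two_neq0 p_odd pL)); rewrite cardL.
have [a aN] := exists_nonsquare_succ_square pL neg1N.
have a0 : a != 0.
  apply/eqP => a0; apply: aN; exists 1.
  by rewrite a0 expr0n addr0 expr1n.
(* [-1] is a nonsquare of [L], hence so is [- a^2]. *)
pose n := - a ^+ 2.
have nN : ~ is_power 2 n.
  move=> [y yE]; apply: neg1N; exists (y / a).
  by rewrite expr_div_n -yE /n mulNr divff // expf_neq0.
have n0 := nonsquare_neq0 nN.
have [w wE wN] := trace0_square iota p_prime cardL cardF F2 omega_neq0 omegaN.
have w0 := nonsquare_neq0 wN.
have [y yE] := nonsquare_mul wN nN.
have y0 : y != 0 by move: (mulf_neq0 w0 n0); rewrite yE expf_eq0.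
(* As [omega^2 n = y^2], this [theta] is a square root of [n]; and
   [theta v = 1/omega] turns [N v^(sigma-1)] into [1/omega^(sigma-1)]. *)
pose v := y^-1; pose theta := iota y / omega.
pose h := ((p ^ s - 1) %/ 2)%N; pose N := n ^+ h; pose l := N * v ^+ (p ^ s - 1).
have ps_odd : odd (p ^ s) by rewrite oddX p_odd orbT.
have psE : (p ^ s = (2 * h).+1)%N by rewrite /h; lia.
have psE' : (p ^ s - 1 = 2 * h)%N by rewrite psE subn1.
have v0 : v != 0 by rewrite invr_eq0.
have N0 : N != 0 by rewrite expf_neq0.
have l0 : l != 0 by rewrite mulf_neq0 ?expf_neq0.
have theta2 : theta ^+ 2 = iota n.
  rewrite expr_div_n -rmorphXn -yE -wE rmorphM mulrAC divff ?mul1r //.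
  by rewrite fmorph_eq0.
have thetaN : conjF p m theta = - theta.
  by rewrite (conjM p m) (conjV p m) omegaN (conj_iota iota cardL) invrN mulrN.
have thetaS : theta ^+ (p ^ s) = iota N * theta.
  by rewrite psE exprSr exprM theta2 rmorphXn.
have lv : l * v = N * v ^+ (p ^ s).
  by rewrite -mulrA -exprSr psE' -psE.
have lE : iota l = (omega ^+ (p ^ s - 1))^-1.
  rewrite rmorphM !rmorphXn -theta2 -exprM psE' -exprMn -exprVn.
  rewrite (_ : theta * iota v = omega^-1) // /theta /v fmorphV.
  by field; rewrite fmorph_eq0 y0 omega_neq0.
have nS : n ^+ (p ^ s) = n * N ^+ 2 by rewrite psE exprS mulnC exprM.
have in0 : iota n != 0 by rewrite fmorph_eq0.
pose beta0 := 1 - theta / iota n.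
(* The norm of [beta0] is [1 - 1/n = (1 + a^2)/a^2]. *)
have beta0N : ~ is_power 2 beta0.
  move=> [x xE]; have [z zE] : exists z, x * conjF p m x = iota z.
    by apply: (conj_fixed iota cardL); rewrite (conjM p m) (conjK cardF) mulrC.
  apply: aN; exists (a * z); rewrite exprMn.
  apply: (fmorph_inj iota); rewrite rmorphM rmorphD rmorph1 !rmorphXn -zE.
  rewrite exprMn -xE -(conjX p m) -xE.
  have -> : conjF p m beta0 = 1 + theta / iota n.
    rewrite (conjB p_prime cardF) (conjM p m) (conjV p m) thetaN.
    by rewrite (conj_iota iota cardL) -(rmorph1 iota) (conj_iota iota cardL); ring.
  rewrite /beta0 (_ : (_ - _) * _ = 1 - theta ^+ 2 / iota n ^+ 2); last by field.
  rewrite theta2 /n rmorphN rmorphXn /=.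
  by field; rewrite oppr_eq0 expf_neq0 ?fmorph_eq0.
have [lam [u0 [lamE lam0 u00 zE]]] : exists lam u0, [/\ conjF p m lam = lam,
    lam != 0, u0 != 0 & beta / beta0 = lam * u0 ^+ (p ^ s + 1)].
  apply: (square_decomposition cardF gcd2 (nonsquare_div betaN beta0N)).
  by rewrite mulf_neq0 ?invr_eq0 // nonsquare_neq0.
have u1 : u0^-1 != 0 by rewrite invr_eq0.
have betaE : beta * u0^-1 ^+ (p ^ s + 1) = lam * beta0.
  rewrite -[beta](divfK (nonsquare_neq0 beta0N)) zE exprVn.
  by field; rewrite expf_neq0.
have [Q [QE isoQ]] := bh2_isotopic_B p_prime cardL cardF F2 n0 N0 v0 u1 theta2
  thetaN thetaS lv lamE lam0 betaE gammaN PE.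
exists Q; split=> //; exists s, l, n, N; split=> //.
  by move: par; rewrite oddD; case: (odd _); case: (odd _); auto.
split=> //; exact: (presemifield_B_cond p_odd pL l0 n0 N0 nS s0 QE).
Qed.
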